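(* Let $n \geq 2$, $\delta > 0$ and $\kappa > 0$. Let $f$ be a neural network with $n$ outputs and inputs in $\mathbb{R}^m$ whose final layer is the softmax, and let $\hat f$ be the approximated network with precision $\delta$, i.e. the network obtained from $f$ by replacing the softmax by the approximated softmax of precision $\delta$ (as defined in the context). Let $$b_{n,\delta} = \frac{n-2}{(\sqrt{n-1}+1)^2} + 2\delta ,$$ let $\vec\epsilon$ be a tolerance vector, and let $\operatorname{cond}(\vec x, \vec x', \vec\epsilon)$ be a Boolean condition relating inputs $\vec x, \vec x' \in \mathbb{R}^m$ to $\vec\epsilon$. Whenever the approximated network is 2-safe for $\operatorname{conf}(\hat f(\vec x)) > \kappa - b_{n,\delta}$, the real network is 2-safe for $\operatorname{conf}(f(\vec x)) > \kappa$, given $\operatorname{conf}(\hat f(\vec x)) > \frac12$. Formally: if $$\forall \vec x, \vec x'.\ \ \operatorname{cond}(\vec x, \vec x', \vec\epsilon) \wedge \operatorname{conf}(\hat f(\vec x)) > \kappa - b_{n,\delta} \;\Longrightarrow\; \operatorname{class}(\hat f(\vec x)) = \operatorname{class}(\hat f(\vec x')),$$ then, for all inputs $\vec x$ with $\operatorname{conf}(\hat f(\vec x)) > \frac12$ and all inputs $\vec x'$, $$\operatorname{cond}(\vec x, \vec x', \vec\epsilon) \wedge \operatorname{conf}(f(\vec x)) > \kappa \;\Longrightarrow\; \operatorname{class}(f(\vec x)) = \operatorname{class}(f(\vec x')).$$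
   Context: Networks. A feed-forward neural network with a softmax final layer is $f = \operatorname{softmax} \circ\, g$, where $g : \mathbb{R}^m \to \mathbb{R}^n$ is the function computed by the layers preceding the softmax (a composition of layers, each consisting of weighted sums followed by componentwise activation functions such as $\operatorname{ReLU}(x)=\max(0,x)$), and for $\vec z\in\mathbb{R}^n$, $\operatorname{softmax}(\vec z)_i = e^{z_i} / \sum_{j=1}^n e^{z_j}$. Approximation. Let $\operatorname{Sig}(x) = \frac{1}{1+e^{-x}}$ and let $\widehat{\operatorname{Sig}} : \mathbb{R} \to \mathbb{R}$ be a fixed piecewise linear approximation of it with $|\widehat{\operatorname{Sig}}(x) - \operatorname{Sig}(x)| \leq \delta$. The approximated softmax with precision $\delta$ is $$\widehat{\operatorname{softmax}}(\vec z)_i = \widehat{\operatorname{Sig}}\Big(z_i - \max_{1\le j\le n,\, j\neq i} z_j - \log(n-1)\Big) - \delta, \qquad 1 \le i \le n,$$ with $\log$ the natural logarithm. The approximated network is $\hat f = \widehat{\operatorname{softmax}} \circ g$. Confidence and class. For an output vector $\vec y = (y_1,\dots,y_n)$, $\operatorname{conf}(\vec y) = \max(y_1,\dots,y_n)$ and $\operatorname{class}(\vec y) = \operatorname{arg\,max}_{1 \le i \le n} y_i$. 2-safety. Here $\operatorname{cond}$ is an arbitrary (generic) Boolean relation. A model $h$ is globally 2-safe for confidence $\kappa$ and tolerance $\vec\epsilon$ iff for all inputs $\vec x,\vec x'$: $\operatorname{cond}(\vec x,\vec x',\vec\epsilon)$ and $\operatorname{conf}(h(\vec x)) > \kappa$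 imply $\operatorname{class}(h(\vec x)) = \operatorname{class}(h(\vec x'))$.
   Formalization: The piecewise linear approximation of Sig is additionally assumed to be nondecreasing; without this the claim is false, since a non-monotone approximation within δ can misorder the classes at the second input x'. *)

(* Defs.v *)
From HB Require Import structures.
From mathcomp Require Import all_boot all_order all_algebra.
From mathcomp Require Import all_classical all_reals all_analysis.
Set Implicit Arguments.
Unset Strict Implicit.
Unset Printing Implicit Defensive.
Import Order.TTheory GRing.Theory Num.Theory.
Import numFieldNormedType.Exports.
Local Open Scope classical_set_scope.
Local Open Scope ring_scope.

(* A term of type [layers R m n] is a feed-forward network from R^m to R^n
   without its softmax: each layer computes weighted sums (with a bias) and
   then applies an activation function to every component. *)
Inductive layers (R : realType) (m : nat) : nat -> Type :=
| NoLayer : layers R m m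
| AddLayer (p n : nat) (N : layers R m p) (W : 'M[R]_(n, p)) (b : 'cV[R]_n)
    (act : 'I_n -> R -> R) : layers R m n.

Fixpoint eval_layers (R : realType) (m n : nat) (N : layers R m n)
    (x : 'cV[R]_m) : 'cV[R]_n :=
  match N in layers _ _ n0 return 'cV[R]_n0 with
  | NoLayer => x
  | AddLayer _ _ N' W b act =>
      \col_i act i ((W *m eval_layers N' x + b) i 0)
  end.

Definition softmax (R : realType) (n : nat) (z : 'cV[R]_n) : 'cV[R]_n :=
  \col_i (expR (z i 0) / \sum_(j < n) expR (z j 0)).

Definition Sig (R : realType) (x : R) : R := 1 / (1 + expR (- x)).

(* The value at the breakpoints [s] is unconstrained, so continuity is not
   imposed; [a] or [b] may lie beyond all breakpoints, which makes [h] affine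
   on the two unbounded pieces as well. *)
Definition piecewise_linear (R : realType) (h : R -> R) : Prop :=
  exists s : seq R, forall a b : R,
    (forall t, t \in s -> ~~ (a < t < b)) ->
    exists c d : R, forall x, a < x < b -> h x = c * x + d.

(* Maximum of the entries with index in [P]; [P] must be nonempty, see
   [max_overP] (the supremum of the empty set is 0). *)
Definition max_over (R : realType) (n : nat) (P : pred 'I_n) (y : 'cV[R]_n)
    : R :=
  sup [set y i 0 | i in [set i | P i]].

Lemma max_overP (R : realType) (n : nat) (P : pred 'I_n) (y : 'cV[R]_n)
    (i0 : 'I_n) : P i0 ->
  (exists2 i, P i & max_over P y = y i 0) /\
  (forall j, P j -> y j 0 <= max_over P y).
Proof.
move=> Pi0.
case: (Order.TotalTheory.arg_maxP (fun i => y i 0) Pi0) => k Pk kmax.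
suff -> : max_over P y = y k 0 by split; [exists k|move=> j /kmax].
apply/eqP; rewrite eq_le; apply/andP; split.
  by apply: ge_sup; [exists (y k 0), k|move=> _ [j /= Pj <-]; exact: kmax].
apply: ub_le_sup; last by exists k.
by exists (y k 0) => _ [j /= Pj <-]; exact: kmax.
Qed.

Definition approx_softmax (R : realType) (n : nat) (aSig : R -> R) (delta : R)
    (z : 'cV[R]_n) : 'cV[R]_n :=
  \col_i (aSig (z i 0 - max_over (fun j => j != i) z - ln (n%:R - 1)) - delta).

Definition network (R : realType) (m n : nat) (g : layers R m n)
    (x : 'cV[R]_m) : 'cV[R]_n :=
  softmax (eval_layers g x).

Definition approx_network (R : realType) (m n : nat) (aSig : R -> R)
    (delta : R) (g : layers R m n) (x : 'cV[R]_m) : 'cV[R]_n :=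
  approx_softmax aSig delta (eval_layers g x).

Definition conf (R : realType) (n : nat) (y : 'cV[R]_n) : R :=
  max_over predT y.

(* The arg max is the set of all maximizing indices: no tie-breaking rule is
   chosen. *)
Definition class (R : realType) (n : nat) (y : 'cV[R]_n) : {set 'I_n} :=
  [set i | [forall j, y j 0 <= y i 0]]%SET.

Definition two_safe (R : realType) (m n k : nat)
    (cond : 'cV[R]_m -> 'cV[R]_m -> 'cV[R]_k -> bool)
    (h : 'cV[R]_m -> 'cV[R]_n) (eps : 'cV[R]_k) (kappa : R) : Prop :=
  forall x x' : 'cV[R]_m,
    cond x x' eps -> kappa < conf (h x) -> class (h x) = class (h x').

Definition conf_bound (R : realType) (n : nat) (delta : R) : R :=
  (n%:R - 2) / (Num.sqrt (n%:R - 1) + 1) ^+ 2 + 2 * delta.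

(* Main.v *)
(* For a maximal index i of z put t = exp (max_(j <> i) z_j - z_i) and
   N = n - 1. Then softmax(z)_i <= 1/(1+t), while the argument of the
   approximated sigmoid has Sig = 1/(1+Nt); their difference is at most
   (N-1)/(sqrt N + 1)^2 by AM-GM (with equality at t = 1/sqrt N). Hence
   conf f <= conf fhat + b, which transfers the confidence threshold.
   If conf fhat > 1/2, the arg max of fhat is a singleton {i}; since fhat is
   weakly monotone in the logits, {i} is then also the arg max of the logits,
   at x and at every x' with the same arg max of fhat. *)
Require Import Defs.
From HB Require Import structures.
From mathcomp Require Import all_boot all_order all_algebra.
From mathcomp Require Import all_classical all_reals all_analysis.
From mathcomp Require Import ring lra.
Set Implicit Arguments.
Unset Strict Implicit.
Unset Printing Implicit Defensive.
Import Order.TTheory GRing.Theory Num.Theory.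
Local Open Scope ring_scope.

Lemma class_singletonP (R : realType) (n : nat) (y : 'cV[R]_n) (i : 'I_n) :
  class y = [set i]%SET <-> forall j, j != i -> y j 0 < y i 0.
Proof.
split=> [yi j ji|yi].
- have yimax k : y k 0 <= y i 0.
    have : i \in class y by rewrite yi inE.
    by rewrite inE => /forallP.
  rewrite ltNge; apply: contra ji => yij.
  have : j \in class y.
    by rewrite inE; apply/forallP => k; exact: le_trans (yimax k) yij.
  by rewrite yi inE.
- apply/setP => j; rewrite !inE; apply/forallP/eqP => [yj|-> k].
    apply/eqP; apply: contraT => /yi.
    by rewrite ltNge yj.
  by have [->//|/yi/ltW] := eqVneq k i.
Qed.

Lemma sum_expR_gt0 (R : realType) (n : nat) (z : 'cV[R]_n) (i : 'I_n) :
  0 < \sum_(j < n) expR (z j 0).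
Proof.
rewrite (bigD1 i) //= ltr_pwDl ?expR_gt0 //.
by apply: sumr_ge0 => j _; exact: expR_ge0.
Qed.

(** All entries share one positive denominator and [expR] is strictly increasing, so softmax
    preserves and reflects the order of the logits. *)
Lemma class_softmax (R : realType) (n : nat) (z : 'cV[R]_n) :
  class (softmax z) = class z.
Proof.
apply/setP => i; rewrite !inE; apply: eq_forallb => j.
by rewrite !mxE ler_pM2r ?ler_expR // invr_gt0 (sum_expR_gt0 z i).
Qed.

Lemma neq_ord_ex (n : nat) (i : 'I_n) : (2 <= n)%N -> exists j, j != i.
Proof.
move=> n2.
have n0 : (0 < n)%N by exact: ltnW.
have [i0|i0] := eqVneq (val i) 0%N.
- by exists (Ordinal n2); rewrite -val_eqE /= i0.
- by exists (Ordinal n0); rewrite -val_eqE /= eq_sym.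
Qed.

(** A maximizer over the indices other than [j] either differs from [i], hence competes on the right
    as well, or is [i] itself, and then [z j 0] dominates it. *)
Lemma max_others_anti (R : realType) (n : nat) (z : 'cV[R]_n) (i j : 'I_n) :
  z i 0 <= z j 0 ->
  max_over (fun k => k != j) z <= max_over (fun k => k != i) z.
Proof.
move=> zij; have [->//|nij] := eqVneq i j.
have [[k kj ->] _] := max_overP (P := fun k => k != j) z nij.
have nji : j != i by rewrite eq_sym.
have [_ ub] := max_overP (P := fun k => k != i) z nji.
have [->|ki] := eqVneq k i; last exact: ub.
by apply: le_trans zij _; exact: ub.
Qed.

Lemma approx_softmax_mono (R : realType) (n : nat) (aSig : R -> R) (delta : R)
    (z : 'cV[R]_n) (i j : 'I_n) :
  {homo aSig : x y / x <= y} -> z i 0 <= z j 0 ->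
  approx_softmax aSig delta z i 0 <= approx_softmax aSig delta z j 0.
Proof.
move=> mono zij; rewrite !mxE lerD2r; apply: mono.
by rewrite lerD2r lerB // max_others_anti.
Qed.

(** Only strict inequalities pull back from outputs to logits: flat pieces of [aSig] can create
    ties. This is why the arg max has to be a singleton. *)
Lemma class_approx_softmax_singleton (R : realType) (n : nat) (aSig : R -> R)
    (delta : R) (z : 'cV[R]_n) (i : 'I_n) :
  {homo aSig : x y / x <= y} ->
  class (approx_softmax aSig delta z) = [set i]%SET -> class z = [set i]%SET.
Proof.
move=> mono /class_singletonP yi; apply/class_singletonP => j /yi.
by rewrite !ltNge; apply: contra; exact: approx_softmax_mono.
Qed.

Lemma Sig_gt_half (R : realType) (x : R) : 1 / 2 < Sig x -> 0 < x.
Proof.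
have E0 := expR_gt0 (- x); rewrite /Sig !div1r ltf_pV2 ?posrE; last 2 first.
- by lra.
- by lra.
by move=> ?; rewrite -oppr_lt0 -expR_lt1; lra.
Qed.

Lemma approx_softmax_gt_half (R : realType) (n : nat) (aSig : R -> R)
    (delta : R) (z : 'cV[R]_n) (i : 'I_n) :
  (2 <= n)%N -> (forall x, `|aSig x - Sig x| <= delta) ->
  1 / 2 < approx_softmax aSig delta z i 0 ->
  forall j, j != i -> z j 0 < z i 0.
Proof.
move=> n2 approx; rewrite mxE => half j ji.
set u := z i 0 - _ - _ in half.
have u0 : 0 < u.
  apply: Sig_gt_half; apply: lt_le_trans half _.
  (* The subtracted [delta] makes the output a lower bound of [Sig u]. *)
  by have := approx u; rewrite ler_norml => /andP[_]; lra.
have [_ /(_ j ji) zj] := max_overP (P := fun k => k != i) z ji.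
have ln0 : 0 <= ln (n%:R - 1 : R).
  by apply: ln_ge0; rewrite lerBrDr (_ : 1 + 1 = 2%:R) // ler_nat.
by move: u0; rewrite /u; lra.
Qed.

Lemma class_approx_softmax (R : realType) (n : nat) (aSig : R -> R)
    (delta : R) (z : 'cV[R]_n) :
  (2 <= n)%N -> (forall x, `|aSig x - Sig x| <= delta) ->
  1 / 2 < conf (approx_softmax aSig delta z) ->
  exists i, class (approx_softmax aSig delta z) = [set i]%SET.
Proof.
move=> n2 approx half.
have n0 : (0 < n)%N by exact: ltnW.
have [[i _ yi] ymax] :=
  max_overP (approx_softmax aSig delta z) (isT : predT (Ordinal n0)).
move: half; rewrite /conf yi => half.
exists i; apply/class_singletonP => j ji.
have zji := approx_softmax_gt_half n2 approx half ji.
(* A rival [j] with at least the output of [i] would also exceed 1/2, so each of the two logits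
   would be strictly larger than the other. *)
apply: contraT; rewrite -leNgt => yij.
have ij : i != j by rewrite eq_sym.
have := approx_softmax_gt_half n2 approx (lt_le_trans half yij) ij.
by rewrite ltNge (ltW zji).
Qed.

Lemma sigmoid_gap (R : rcfType) (N t : R) : 1 <= N -> 0 < t ->
  1 / (1 + t) - 1 / (1 + N * t) <= (N - 1) / (Num.sqrt N + 1) ^+ 2.
Proof.
move=> N1 t0.
have s0 : 0 <= Num.sqrt N := sqrtr_ge0 N.
have : Num.sqrt N ^+ 2 = N by rewrite sqr_sqrtr //; lra.
move: (Num.sqrt N) s0 => s s0 sN.
have Nt : 0 < N * t by apply: mulr_gt0 => //; lra.
have -> : 1 / (1 + t) - 1 / (1 + N * t)
    = (N - 1) * (t / ((1 + t) * (1 + N * t))).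
  by field; rewrite !gt_eqF //; lra.
apply: ler_wpM2l; first by lra.
rewrite ler_pdivrMr ?mulr_gt0 //; [|lra..].
rewrite mulrC ler_pdivlMr ?exprn_gt0 //; last by lra.
rewrite -sN -subr_ge0.
(* With denominators cleared, AM-GM becomes the nonnegativity of a square. *)
suff -> : (1 + t) * (1 + s ^+ 2 * t) - t * (s + 1) ^+ 2 = (s * t - 1) ^+ 2
  by exact: sqr_ge0.
by ring.
Qed.

(** Keep only the terms of [i] and [j] in the denominator. *)
Lemma softmax_le_sigmoid (R : realType) (n : nat) (z : 'cV[R]_n)
    (i j : 'I_n) : j != i ->
  softmax z i 0 <= 1 / (1 + expR (z j 0 - z i 0)).
Proof.
move=> ji; rewrite mxE.
have zi0 := expR_gt0 (z i 0); have zj0 := expR_gt0 (z j 0).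
have -> : 1 / (1 + expR (z j 0 - z i 0))
    = expR (z i 0) / (expR (z i 0) + expR (z j 0)).
  by rewrite expRD expRN; field; rewrite !gt_eqF //; lra.
rewrite ler_pM2l // lef_pV2 ?posrE ?(sum_expR_gt0 z i) ?addr_gt0 //.
rewrite (bigD1 i) //= lerD2l (bigD1 j) //= lerDl.
by apply: sumr_ge0 => k _; exact: expR_ge0.
Qed.

Lemma softmax_approx_gap (R : realType) (n : nat) (aSig : R -> R)
    (delta : R) (z : 'cV[R]_n) (i : 'I_n) :
  (2 <= n)%N -> (forall x, `|aSig x - Sig x| <= delta) ->
  softmax z i 0 <= approx_softmax aSig delta z i 0 + conf_bound n delta.
Proof.
move=> n2 approx; have [j0 j0i] := neq_ord_ex i n2.
have [[j ji zj] _] := max_overP (P := fun k => k != i) z j0i.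
rewrite [approx_softmax _ _ _ _ _]mxE zj /conf_bound.
have N1 : 1 <= n%:R - 1 :> R.
  by rewrite lerBrDr (_ : 1 + 1 = 2%:R) // ler_nat.
set u := z i 0 - z j 0 - _.
(* The shift by the logarithm turns into the factor N of [sigmoid_gap]. *)
have SigE : Sig u = 1 / (1 + (n%:R - 1) * expR (z j 0 - z i 0)).
  have -> : u = - (ln (n%:R - 1) + (z j 0 - z i 0)) by rewrite /u; ring.
  by rewrite /Sig opprK expRD lnK // posrE; lra.
have := softmax_le_sigmoid z ji.
have := sigmoid_gap N1 (expR_gt0 (z j 0 - z i 0)).
have -> : n%:R - 1 - 1 = n%:R - 2 :> R by ring.
(* Of the [2 * delta] in the bound, one [delta] pays for the error of [aSig] and one for the [delta]
   subtracted in [approx_softmax]. *)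
have := approx u; rewrite ler_norml -SigE => /andP[+ _].
by lra.
Qed.

Lemma conf_softmax_approx_gap (R : realType) (n : nat) (aSig : R -> R)
    (delta : R) (z : 'cV[R]_n) :
  (2 <= n)%N -> (forall x, `|aSig x - Sig x| <= delta) ->
  conf (softmax z) <= conf (approx_softmax aSig delta z) + conf_bound n delta.
Proof.
move=> n2 approx.
have i0 : 'I_n by exact: Ordinal (ltnW n2).
have [[i _ yi] _] := max_overP (softmax z) (isT : predT i0).
have [_ ub] := max_overP (approx_softmax aSig delta z) (isT : predT i0).
rewrite {1}/conf yi; apply: le_trans (softmax_approx_gap z i n2 approx) _.
by rewrite lerD2r; exact: ub.
Qed.

Theorem theorem3 (R : realType) (m n k : nat) (delta kappa : R)
    (aSig : R -> R) (g : layers R m n) (eps : 'cV[R]_k)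
    (cond : 'cV[R]_m -> 'cV[R]_m -> 'cV[R]_k -> bool)
    (hn : (2 <= n)%N) (hdelta : 0 < delta) (hkappa : 0 < kappa)
    (aSig_pl : piecewise_linear aSig)
    (aSig_mono : {homo aSig : x y / x <= y})
    (aSig_approx : forall x, `|aSig x - Sig x| <= delta) :
  two_safe cond (approx_network aSig delta g) eps
    (kappa - conf_bound n delta) ->
  forall x : 'cV[R]_m, 1 / 2 < conf (approx_network aSig delta g x) ->
  forall x' : 'cV[R]_m,
    cond x x' eps /\ kappa < conf (network g x) ->
    class (network g x) = class (network g x').
Proof.
move=> safe x half x' [cxx' hconf].
have classE : class (approx_network aSig delta g x) =
              class (approx_network aSig delta g x').
  apply: safe cxx' _; rewrite ltrBlDr; apply: lt_le_trans hconf _.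
  exact: conf_softmax_approx_gap.
(* The confidence exceeds 1/2 at [x] only; at [x'] the singleton comes from [classE]. *)
have [i xi] := class_approx_softmax hn aSig_approx half.
have x'i : class (approx_network aSig delta g x') = [set i]%SET.
  by rewrite -classE.
rewrite /network !class_softmax.
rewrite (class_approx_softmax_singleton aSig_mono xi).
by rewrite (class_approx_softmax_singleton aSig_mono x'i).
Qed.
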